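(* Let $\mathbb{X}$ be a finite set of distinct points in $\mathbb{P}^{n_1}\times\cdots\times\mathbb{P}^{n_r}$, let $P\in\mathbb{X}$ be any point, and let $\mathbb{Y}=\mathbb{X}\setminus\{P\}$. Then for all $\underline{i}\in\mathbb{N}^r$, \[H_{\mathbb{Y}}(\underline{i})=\begin{cases} H_{\mathbb{X}}(\underline{i}) & \text{if } \underline{i}\notin D_{\deg_{\mathbb{X}}(P)},\\ H_{\mathbb{X}}(\underline{i})-1 & \text{if } \underline{i}\in D_{\deg_{\mathbb{X}}(P)}.\end{cases}\]
   Context: Let $k$ be an algebraically closed field of characteristic zero, let $r,n_1,\ldots,n_r$ be positive integers, $\mathbb{N}=\{0,1,2,\ldots\}$, and let $R=k[x_{1,0},\ldots,x_{1,n_1},\ldots,x_{r,0},\ldots,x_{r,n_r}]$ be $\mathbb{N}^r$-graded by $\deg x_{i,j}=e_i$, the $i$th standard basis vector of $\mathbb{N}^r$. For a finite set of points $\mathbb{X}$ in $\mathbb{P}^{n_1}\times\cdots\times\mathbb{P}^{n_r}$ (over $k$), $I_{\mathbb{X}}\subseteq R$ is the multihomogeneous ideal generated by the multihomogeneous forms vanishing at all points of $\mathbb{X}$ (so $I_{\emptyset}=R$). The Hilbert function of $\mathbb{X}$ is $H_{\mathbb{X}}(\underline{i})=\dim_k R_{\underline{i}}-\dim_k (I_{\mathbb{X}})_{\underline{i}}$ for $\underline{i}\in\mathbb{N}^r$. Order $\mathbb{N}^r$ by $(i_1,\ldots,i_r)\succeq(j_1,\ldots,j_r)$ iff $i_t\ge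 j_t$ for all $t$; $\min S$ denotes the set of minimal elements of $S\subseteq\mathbb{N}^r$. For a finite set $S\subseteq\mathbb{N}^r$, $D_S=\bigcup_{\underline{s}\in S}\{\underline{j}\in\mathbb{N}^r : \underline{j}\succeq\underline{s}\}$. For $P\in\mathbb{X}$, a multihomogeneous form $F\in R$ is a separator for $P$ if $F(P)\neq0$ and $F(Q)=0$ for all $Q\in\mathbb{X}\setminus\{P\}$. The degree of $P\in\mathbb{X}$ is the (finite) set $\deg_{\mathbb{X}}(P)=\min\{\deg F : F \text{ is a separator for } P\in\mathbb{X}\}\subseteq\mathbb{N}^r$. *)

(* Defs.v *)
From HB Require Import structures.
From mathcomp Require Import all_boot all_order all_algebra.
From mathcomp Require Import finmap.
From mathcomp Require Import boolp classical_sets.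
From mathcomp Require Import mpoly.

Set Implicit Arguments.
Unset Strict Implicit.
Unset Printing Implicit Defensive.

Import GRing.Theory.

Local Open Scope ring_scope.
Local Open Scope classical_set_scope.

Section Ideal.
Variable A : comNzRingType.

Definition ideal_gen (S : set A) : set A :=
  [set F | exists2 s : seq (A * A),
    (forall c, c \in s -> S c.2) & F = \sum_(c <- s) c.1 * c.2].

Lemma ideal_gen0 S : ideal_gen S 0.
Proof. by exists [::] => //; rewrite big_nil. Qed.

Lemma ideal_genD S F G : ideal_gen S F -> ideal_gen S G -> ideal_gen S (F + G).
Proof.
move=> [s hs ->] [t ht ->]; exists (s ++ t); last by rewrite big_cat.
by move=> c; rewrite mem_cat => /orP[/hs|/ht].
Qed.

Lemma ideal_genM S F G : ideal_gen S G -> ideal_gen S (F * G).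
Proof.
move=> [s hs ->]; exists [seq (F * c.1, c.2) | c <- s].
  by move=> _ /mapP[c /hs hc ->].
by rewrite big_map mulr_sumr; apply: eq_bigr => c _; rewrite mulrA.
Qed.

End Ideal.

Lemma ex_vspace (k : fieldType) (V : vectType k) (W : set V) :
  W 0 -> (forall a u v, W u -> W v -> W (a *: u + v)) ->
  exists U : {vspace V}, forall v, v \in U <-> W v.
Proof.
move=> W0 WD; pose Q d := `[< exists U : {vspace V},
  \dim U = d /\ forall v, v \in U -> W v >].
have exQ : exists d, Q d.
  by exists 0%N; apply/asboolP; exists 0%VS; split=> [|v];
    rewrite ?dimv0 // memv0 => /eqP->.
have ubQ d : Q d -> (d <= \dim {:V})%N.
  by move=> /asboolP[U [<- _]]; exact: dimvS (subvf U).
case: (ex_maxnP exQ ubQ) => d /asboolP[U [dU UW]] maxd; exists U => v.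
split=> [/UW //|Wv]; apply/negPn/negP => vNU.
have : Q (\dim (<[v]> + U)%VS).
  apply/asboolP; exists (<[v]> + U)%VS; split=> // w.
  by move=> /memv_addP[_ /vlineP[a ->] [u /UW Wu ->]]; exact: WD.
move=> /maxd; rewrite -dU => le_dim.
have := dimv_leqif_eq (addvSr <[v]>%VS U).
move=> [le_U /esym]; rewrite eqn_leq le_U le_dim => /eqP eqU.
by move/negP: vNU; apply; rewrite eqU; apply: subvP (addvSl _ _) _ (memv_line v).
Qed.

(* Points of the projective space P^m: lines through the origin in k^(m+1). *)
Definition proj (k : fieldType) (m : nat) : choiceType :=
  {L : {vspace 'rV[k]_m.+1} | \dim L == 1%N}.

Section MultiProjective.
Variables (k : fieldType) (r : nat) (n : 'I_r -> nat).

Definition mproj : choiceType := {dffun forall i : 'I_r, proj k (n i)}.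

(* The variables x_(i,j) are indexed by the pairs (i, j) with j <= n i, which
   are numbered so as to use the polynomial ring {mpoly k[_]}.  The grading
   monoid N^r is 'X_{1..r}, with its pointwise order (_ <= _)%MM. *)
Definition nvar : nat := #|{: {i : 'I_r & 'I_(n i).+1}}|.

Definition var (i : 'I_r) (j : 'I_(n i).+1) : 'I_nvar :=
  enum_rank (Tagged (fun i => 'I_(n i).+1) j).

Definition multidegree (m : 'X_{1..nvar}) : 'X_{1..r} :=
  [multinom \sum_(j < (n i).+1) m (var j) | i < r].

Definition mhomog_pred (d : 'X_{1..r}) : pred {mpoly k[nvar]} :=
  fun F => all (fun m => multidegree m == d) (msupp F).

Definition mhomog (d : 'X_{1..r}) := [qualify a F | mhomog_pred d F].

Lemma mhomogP d (F : {mpoly k[nvar]}) :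
  reflect {in msupp F, forall m, multidegree m = d} (F \is a mhomog d).
Proof. by apply/(iffP allP)=> /= h m /h => [/eqP|->]. Qed.

Lemma mhomogX d m : ('X_[m] \is a mhomog d) = (multidegree m == d).
Proof. by rewrite qualifE /= /mhomog_pred msuppX /= andbT. Qed.

Lemma mhomog_coeff0 d (F : {mpoly k[nvar]}) m :
  F \is a mhomog d -> multidegree m != d -> F@_m = 0.
Proof.
move/mhomogP=> hF; apply/contraTeq; rewrite -mcoeff_msupp.
by move/hF=> ->; rewrite negbK.
Qed.

Fact mhomog_submod_closed d : submod_closed (mhomog_pred d).
Proof.
split=> [|c F G]; first by rewrite unfold_in /= /mhomog_pred msupp0.
move=> /mhomogP hF /mhomogP hG; apply/mhomogP=> m.
by move/msuppD_le; rewrite mem_cat => /orP[/msuppZ_le/hF|/hG].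
Qed.

HB.instance Definition _ d :=
  GRing.isSubmodClosed.Build k {mpoly k[nvar]} (mhomog_pred d)
    (mhomog_submod_closed d).

Record mform (d : 'X_{1..r}) := MForm {
  mpoly_of_mform :> {mpoly k[nvar]};
  _ : mpoly_of_mform \in mhomog_pred d }.

HB.instance Definition _ d := [isSub for @mpoly_of_mform d].
HB.instance Definition _ d := [Choice of mform d by <:].
HB.instance Definition _ d := [SubChoice_isSubLmodule of mform d by <:].

Lemma mdeg_multidegree m : mdeg (multidegree m) = mdeg m.
Proof.
rewrite !mdegE.
rewrite [RHS](reindex (@enum_rank {i : 'I_r & 'I_(n i).+1})); last first.
  by exists enum_val => v _; rewrite ?enum_rankK ?enum_valK.
rewrite (eq_bigr (fun i : 'I_r => \sum_(j < (n i).+1) m (var j))%N); last first.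
  by move=> i _; rewrite mnmE.
rewrite (sig_big_dep xpredT (fun _ _ => true)
  (fun i (j : 'I_(n i).+1) => m (var j))) /=.
by apply: eq_bigr => -[i j] _.
Qed.

Definition mform_monomials (d : 'X_{1..r}) : {set 'X_{1..nvar < (mdeg d).+1}} :=
  [set m | multidegree (bmnm m) == d]%SET.

Fact mform_vecaxiom d : Vector.axiom #|mform_monomials d| (mform d).
Proof.
pose B (i : 'I_#|mform_monomials d|) : 'X_{1..nvar} := bmnm (enum_val i).
have B_inj : injective B by move=> i j /val_inj /enum_val_inj.
pose f (F : mform d) : 'rV[k]__ := \row_i F@_(B i).
exists f => [c F G|]; first by apply/rowP => i; rewrite !mxE /= mcoeffD mcoeffZ.
pose g (v : 'rV[k]_#|mform_monomials d|) : {mpoly k[nvar]} :=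
  \sum_i v 0 i *: 'X_[B i].
have gh v : g v \in mhomog_pred d.
  apply: rpred_sum => i _; apply: rpredZ.
  have -> : ('X_[B i] \in mhomog_pred d) = (multidegree (B i) == d).
    exact: mhomogX.
  by have := enum_valP i; rewrite inE.
have gE v i : (g v)@_(B i) = v 0 i.
  rewrite raddf_sum /= (bigD1 i) //= mcoeffZ mcoeffX eqxx mulr1 big1 ?addr0 //.
  by move=> j ji; rewrite mcoeffZ mcoeffX (inj_eq B_inj) (negbTE ji) mulr0.
exists (fun v => MForm (gh v)) => [F|v]; last first.
  by apply/rowP => i; rewrite mxE gE.
apply/val_inj/mpolyP => m /=.
have [md|mNd] := eqVneq (multidegree m) d; last first.
  by rewrite (mhomog_coeff0 (gh (f F)) mNd) (mhomog_coeff0 (valP F) mNd).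
have lt_m : (mdeg m < (mdeg d).+1)%N by rewrite -md mdeg_multidegree.
have mB : BMultinom lt_m \in mform_monomials d by rewrite inE /= md.
have -> : m = B (enum_rank_in mB (BMultinom lt_m)) by rewrite /B enum_rankK_in.
by rewrite gE mxE.
Qed.

HB.instance Definition _ d :=
  Lmodule_hasFinDim.Build k (mform d) (@mform_vecaxiom d).

Definition coord_of (a : forall i : 'I_r, 'rV[k]_(n i).+1) : 'I_nvar -> k :=
  fun v => a (tag (enum_val v)) 0 (tagged (enum_val v)).

Definition representative (P : mproj) (i : 'I_r) : 'rV[k]_(n i).+1 :=
  vpick (val (P i)).

(* The value of F at the chosen representative of P; for multihomogeneous F its
   vanishing does not depend on that choice, see mvalue_eq0. *)
Definition mvalue (F : {mpoly k[nvar]}) (P : mproj) : k :=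
  F.@[coord_of (representative P)].

Lemma mvalue_eq0 (F : {mpoly k[nvar]}) d (P : mproj)
    (a : forall i : 'I_r, 'rV[k]_(n i).+1) :
  F \is a mhomog d -> (forall i, a i != 0) -> (forall i, a i \in val (P i)) ->
  (mvalue F P == 0) = (F.@[coord_of a] == 0).
Proof.
move=> hF a0 aP.
have ex_c i : exists c : k, a i == c *: representative P i.
  have dP : \dim (val (P i)) = 1%N := eqP (valP (P i)).
  have pick0 : representative P i != 0 by rewrite vpick0 -dimv_eq0 dP.
  have : a i \in <[representative P i]>%VS.
    suff -> : <[representative P i]>%VS = val (P i) by [].
    by apply/eqP; rewrite eqEdim -memvE memv_pick dP dim_vline pick0.
  by move=> /vlineP[c ->]; exists c.
pose c i := xchoose (ex_c i).
have ac i : a i = c i *: representative P i by exact/eqP/(xchooseP (ex_c i)).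
have c0 i : c i != 0.
  by apply/eqP => ci0; move: (a0 i); rewrite ac ci0 scale0r eqxx.
suff -> : F.@[coord_of a] = (\prod_i c i ^+ d i) * mvalue F P.
  have /negbTE c_neq0 : \prod_i c i ^+ d i != 0.
    by apply/prodf_neq0 => i _; rewrite expf_neq0.
  by rewrite mulf_eq0 c_neq0.
rewrite /mvalue !mevalE mulr_sumr big_seq [RHS]big_seq.
apply: eq_bigr => m /(mhomogP _ _ hF) md; rewrite mulrCA; congr (_ * _).
rewrite (eq_bigr (fun v => c (tag (enum_val v)) ^+ m v *
    coord_of (representative P) v ^+ m v)); last first.
  by move=> v _; rewrite /coord_of ac mxE exprMn.
rewrite big_split /=; congr (_ * _).
rewrite (reindex (@enum_rank {i : 'I_r & 'I_(n i).+1})); last first.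
  by exists enum_val => v _; rewrite ?enum_rankK ?enum_valK.
rewrite -md [RHS](eq_bigr (fun i : 'I_r =>
    \prod_(j < (n i).+1) c i ^+ m (var j))); last first.
  by move=> i _; rewrite mnmE expr_sum.
rewrite (sig_big_dep xpredT (fun _ _ => true)
  (fun i (j : 'I_(n i).+1) => c i ^+ m (var j))) /=.
by apply: eq_bigr => -[i j] _; rewrite enum_rankK.
Qed.

Definition vanishing_ideal (X : {fset mproj}) : set {mpoly k[nvar]} :=
  ideal_gen [set F | (exists d, F \is a mhomog d) /\
                     forall P, P \in X -> mvalue F P = 0].

Lemma ex_vanishing_piece (X : {fset mproj}) d :
  exists U : {vspace mform d},
    forall F, F \in U <-> vanishing_ideal X (mpoly_of_mform F).
Proof.
apply: ex_vspace => [|a F G hF hG]; first exact: ideal_gen0.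
by rewrite /= -mul_mpolyC; apply: ideal_genD => //; exact: ideal_genM.
Qed.

Definition vanishing_piece (X : {fset mproj}) d : {vspace mform d} :=
  sval (cid (ex_vanishing_piece X d)).

Lemma vanishing_pieceP (X : {fset mproj}) d (F : mform d) :
  F \in vanishing_piece X d <-> vanishing_ideal X F.
Proof. exact: svalP (cid (ex_vanishing_piece X d)) F. Qed.

Definition hilbert (X : {fset mproj}) (d : 'X_{1..r}) : int :=
  (\dim {:mform d})%:Z - (\dim (vanishing_piece X d))%:Z.

Definition separator (X : {fset mproj}) (P : mproj) d (F : {mpoly k[nvar]}) :=
  [/\ F \is a mhomog d, mvalue F P != 0 &
      forall Q, Q \in (X `\ P)%fset -> mvalue F Q = 0].

End MultiProjective.

Definition minimal_elements (r : nat) (S : set 'X_{1..r}) : set 'X_{1..r} :=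
  [set d | S d /\ forall e, S e -> (e <= d)%MM -> e = d].

Definition up_closure (r : nat) (S : set 'X_{1..r}) : set 'X_{1..r} :=
  [set d | exists2 s, S s & (s <= d)%MM].

Definition point_degree (k : fieldType) (r : nat) (n : 'I_r -> nat)
    (X : {fset mproj k n}) (P : mproj k n) : set 'X_{1..r} :=
  minimal_elements
    [set d | exists F, separator X P d F].

(* Main.v *)
Require Import Defs.
From mathcomp Require Import all_boot all_order all_algebra.
From mathcomp Require Import finmap.
From mathcomp Require Import boolp classical_sets.
From mathcomp Require Import mpoly.

(** The vanishing ideal of a set of points contains, in each multidegree d, just
    the forms that vanish at all of its points ([vanishing_piece_forms]).  Hence
    for Y = X \ P the piece of I_X is the kernel, inside the piece of I_Y, of
    the evaluation at P.  As evaluation is a linear functional, the two pieces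
    are equal when it is zero on the piece of I_Y, and otherwise differ by one
    dimension.  A form in the piece of I_Y with nonzero value at P is the same
    thing as a separator of degree d, so the Hilbert functions differ by one
    exactly in the degrees of separators ([dim_vanishing_pieceD1],
    [vanishing_pieceD1_nosep]).

    These degrees are the up-closure of their minimal elements: every separator
    degree lies above a minimal one, because the total degree cannot decrease
    forever ([up_closure_minimal]), and conversely a separator can be moved up
    to any larger degree by multiplying it with a monomial in coordinates that
    do not vanish at P ([ex_nonvanishing_monomial]). *)

Set Implicit Arguments.
Unset Strict Implicit.
Unset Printing Implicit Defensive.

Import GRing.Theory.

Local Open Scope ring_scope.
Local Open Scope classical_set_scope.

(** The pointwise order on multidegrees is well founded, since the total degree
    strictly decreases along it. *)
Lemma up_closure_minimal (r : nat) (S : set 'X_{1..r}) d :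
  up_closure S d -> up_closure (minimal_elements S) d.
Proof.
move=> [s]; elim: {s}(mdeg s).+1 {-2}s (ltnSn (mdeg s)) => // N IH s ltN Ss sd.
have [minS|] := pselect (forall e, S e -> (e <= s)%MM -> e = s); first by exists s.
move=> /existsNP[e /not_implyP[Se /not_implyP[es e_neq]]].
apply: (IH e) => //; last exact: lepm_trans es sd.
apply: leq_trans (ltN : (mdeg s <= N)%N).
have -> : s = (s - e + e)%MM by rewrite submK.
rewrite mdegD -[X in (X < _)%N]add0n ltn_add2r lt0n mdeg_eq0.
apply/eqP => se0; apply: e_neq.
by rewrite -[RHS](submK es) se0 add0m.
Qed.

Section Evaluation.
Variables (k : fieldType) (r : nat) (n : 'I_r -> nat).
Implicit Types (P Q : mproj k n) (X : {fset mproj k n}).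

Lemma multidegreeD (m1 m2 : 'X_{1..nvar n}) :
  multidegree (m1 + m2)%MM = (multidegree m1 + multidegree m2)%MM.
Proof.
apply/mnmP => i; rewrite mnmDE !mnmE -big_split /=.
by apply: eq_bigr => j _; rewrite mnmDE.
Qed.

Lemma mhomogM d e (F G : {mpoly k[nvar n]}) :
  F \is a mhomog k n d -> G \is a mhomog k n e -> F * G \is a mhomog k n (d + e)%MM.
Proof.
move=> /mhomogP hF /mhomogP hG; apply/mhomogP => m /msuppM_le.
by case/allpairsP => -[m1 m2] /= [/hF <- /hG <- ->]; exact: multidegreeD.
Qed.

Lemma mvalueM (F G : {mpoly k[nvar n]}) P :
  mvalue (F * G) P = mvalue F P * mvalue G P.
Proof. exact: mevalM. Qed.

Lemma representative_neq0 P i : representative P i != 0.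
Proof. by rewrite vpick0 -dimv_eq0 (eqP (valP (P i))). Qed.

(** Some coordinate x_(i, c i) is nonzero at P for each i; the monomial takes
    the whole degree in the i-th block of variables from that coordinate. *)
Lemma ex_nonvanishing_monomial P (e : 'X_{1..r}) :
  exists2 m : 'X_{1..nvar n},
    multidegree m = e & mvalue ('X_[m] : {mpoly k[nvar n]}) P != 0.
Proof.
have ex_c i : exists j, representative P i 0 j != 0.
  by apply/rV0Pn; exact: representative_neq0.
pose c i := xchoose (ex_c i).
have c_neq0 i : representative P i 0 (c i) != 0 := xchooseP (ex_c i).
pose m : 'X_{1..nvar n} := [multinom let w := enum_val v in
  if tagged w == c (tag w) then e (tag w) else 0%N | v < nvar n].
exists m.
  apply/mnmP => i; rewrite mnmE (bigD1 (c i)) //= mnmE enum_rankK /= eqxx.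
  rewrite big1 ?addn0 // => j /negbTE jc.
  by rewrite mnmE enum_rankK /= jc.
rewrite /mvalue mevalX; apply/prodf_neq0 => v _.
rewrite mnmE /coord_of /=; case: ifP => [/eqP ->|_].
  by rewrite expf_neq0.
by rewrite expr0 oner_eq0.
Qed.

Lemma separator_upward X P s d (F : {mpoly k[nvar n]}) :
  separator X P s F -> (s <= d)%MM -> exists G, separator X P d G.
Proof.
move=> [hF FP FQ] sd.
have [m md mP] := ex_nonvanishing_monomial P (d - s)%MM.
exists ('X_[m] * F); split.
- by rewrite -(submK sd) mhomogM // mhomogX md.
- by rewrite mvalueM mulf_neq0.
- by move=> Q /FQ FQ0; rewrite mvalueM FQ0 mulr0.
Qed.

Lemma up_closure_point_degree X P d :
  up_closure (point_degree X P) d <-> exists F, separator X P d F.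
Proof.
split=> [[s [[F sepF] _] sd]|exF]; first exact: separator_upward sepF sd.
by apply: up_closure_minimal; exists d => //; exact: lepm_refl.
Qed.

(** Evaluation at the representatives is a ring morphism that kills the
    generators of the ideal; conversely, a vanishing form is a generator. *)
Lemma vanishing_piece_forms X d (F : mform k n d) :
  F \in vanishing_piece X d <-> forall Q, Q \in X -> mvalue F Q = 0.
Proof.
split=> [/vanishing_pieceP[s sX FE] Q QX|FX].
  rewrite FE /mvalue raddf_sum big_seq big1 // => c /sX[_ cX].
  by rewrite /= mevalM -[X in _ * X]/(mvalue c.2 Q) cX // mulr0.
apply/vanishing_pieceP; exists [:: (1, mpoly_of_mform F)].
  by move=> c; rewrite inE => /eqP ->; split=> //; exists d; exact: valP F.
by rewrite big_seq1 mul1r.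
Qed.

Lemma vanishing_piece_D1 X P d (F : mform k n d) : P \in X ->
  F \in vanishing_piece X d <->
  F \in vanishing_piece (X `\ P)%fset d /\ mvalue F P = 0.
Proof.
move=> PX; split=> [/vanishing_piece_forms FX|[/vanishing_piece_forms FY FP]].
  split; last exact: FX.
  by apply/vanishing_piece_forms => Q; rewrite in_fsetD1 => /andP[_]; exact: FX.
apply/vanishing_piece_forms => Q QX; have [->//|QP] := eqVneq Q P.
by apply: FY; rewrite in_fsetD1 QP.
Qed.

Lemma vanishing_pieceD1_nosep X P d : P \in X ->
  ~ (exists F, separator X P d F) ->
  vanishing_piece (X `\ P)%fset d = vanishing_piece X d.
Proof.
move=> PX nosep; apply/vspaceP => F; apply/idP/idP; last first.
  by case/(vanishing_piece_D1 _ PX).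
move=> FY; apply/(vanishing_piece_D1 _ PX); split=> //.
apply/eqP/negPn/negP => FP; apply: nosep; exists F; split=> //.
  exact: valP F.
exact/vanishing_piece_forms.
Qed.

(** A separator G spans a complement of the kernel of evaluation at P: any F
    differs from (F(P) / G(P)) G by a form that vanishes at P. *)
Lemma dim_vanishing_pieceD1 X P d (F : {mpoly k[nvar n]}) : P \in X ->
  separator X P d F ->
  \dim (vanishing_piece (X `\ P)%fset d) = (\dim (vanishing_piece X d)).+1.
Proof.
move=> PX [hF FP FY]; pose G : mform k n d := MForm hF.
have GY : G \in vanishing_piece (X `\ P)%fset d.
  by apply/vanishing_piece_forms.
have G0 : G != 0.
  apply: contraNneq FP => G0; rewrite -[F]/(mpoly_of_mform G) G0.
  by rewrite /mvalue meval0.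
have mvalueBZ (H : mform k n d) a :
    mvalue (H - a *: G) P = mvalue H P - a * mvalue F P.
  by rewrite /mvalue /= mevalB mevalZ.
suff -> : vanishing_piece (X `\ P)%fset d = (<[G]> + vanishing_piece X d)%VS.
  rewrite dimv_disjoint_sum ?dim_vline ?G0 //.
  apply/eqP; rewrite -subv0; apply/subvP => _ /memv_capP[/vlineP[a ->]].
  case/(vanishing_piece_D1 _ PX) => _ /eqP.
  rewrite /mvalue /= mevalZ mulf_eq0 (negbTE FP) orbF => /eqP ->.
  by rewrite scale0r mem0v.
apply/vspaceP => H; apply/idP/idP => [HY|]; last first.
  case/memv_addP => _ /vlineP[a ->] [K /(vanishing_piece_D1 _ PX)[KY _] ->].
  by rewrite rpredD ?rpredZ.
pose a := mvalue H P / mvalue F P.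
rewrite -[H](subrK (a *: G)) addrC memv_add ?rpredZ ?memv_line //.
apply/(vanishing_piece_D1 _ PX); split; first by rewrite rpredB ?rpredZ.
by rewrite mvalueBZ divfK // subrr.
Qed.

End Evaluation.

Local Close Scope classical_set_scope.
Local Close Scope ring_scope.
Unset Implicit Arguments.

Theorem theorem2p2 (k : closedFieldType) (k_char0 : [pchar k]%R =i pred0)
    (r : nat) (r_gt0 : 0 < r) (n : 'I_r -> nat) (n_gt0 : forall i, 0 < n i)
    (X : {fset mproj k n}) (P : mproj k n) (PX : P \in X) (d : 'X_{1..r}) :
  (~ up_closure (point_degree X P) d ->
     hilbert (X `\ P)%fset d = hilbert X d) /\
  (up_closure (point_degree X P) d ->
     hilbert (X `\ P)%fset d = (hilbert X d - 1)%R).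
Proof.
rewrite /hilbert; split=> [nosep|/up_closure_point_degree[F sepF]].
  rewrite vanishing_pieceD1_nosep // => sep.
  exact/nosep/up_closure_point_degree.
by rewrite (dim_vanishing_pieceD1 PX sepF) -addn1 PoszD opprD addrA.
Qed.
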